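(* Let $X$ be a compact metric space with metric $d$ and let $f:X\to X$ be continuous. (a) For all $x,y\in X$ with $x\,\mathcal{C}\,y$ there exist a sequence $\{\varepsilon_n\}_{n\ge1}$ of positive reals with $\varepsilon_n\to0$ and a family $\{C_n\}_{n\ge1}$, where $C_n$ is an $\varepsilon_n$-chain from $x$ to $y$, such that: (1) $\widehat{C_n}\subseteq\widehat{C_{n+1}}$ for every $n$; (2) every $C_n$ is acyclic. (b) Let $x,y\in X$, let $\varepsilon_n\to 0$ be positive reals, and let $\{C_n\}_{n\ge1}$ be an order-compatible sequence of nested, acyclic $\varepsilon_n$-chains from $x$ to $y$. Put $S=\bigcup_n\widehat{C_n}$. Then there is a unique linear order $\le_\infty$ on $S\setminus\{x,y\}$ whose restriction to $\widehat{C_n}\setminus\{x,y\}$ is the order $\le_n$ induced by the indices of $C_n$, for every $n$; hence $\{C_n\}$ determines a unique limit order-type, that of $(S\setminus\{x,y\},\le_\infty)$. (c) For $x,y\in X$, a compatible metric $d$ on $X$ and a sequence $\varepsilon=\{\varepsilon_n\}$ of positive reals with $\varepsilon_n\to0$, let $\Omega_{f,d,\varepsilon}(x,y)$ be the collection of all limit order-types obtained as in (b) from order-compatible sequences of nested, acyclic $\varepsilon_n$-chains (with respect to $d$) from $x$ to $y$. Then $\Omega_{f,d,\varepsilon}(x,y)$ depends neither on $\varepsilon$ nor on the compatible metric $d$; denote it $\Omega_f(x,y)$. Moreover it is invariant under topological conjugacy: if $Y$ is a compact metric space, $g:Y\to Y$ is continuous and $h:X\to Y$ is a homeomorphism with $h\circ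 f=g\circ h$, then $\Omega_f(x,y)=\Omega_g(h(x),h(y))$ for all $x,y\in X$.
   Context: For $\varepsilon>0$, an $\varepsilon$-chain from $x$ to $y$ is a finite indexed sequence $C:x_0,x_1,\dots,x_m$ of points of $X$ with $m\ge1$, $x_0=x$, $x_m=y$ and $d(f(x_i),x_{i+1})<\varepsilon$ for $i=0,\dots,m-1$. Its support is $\widehat C=\{x_0,\dots,x_m\}$. One writes $x\,\mathcal{C}\,y$ ($x$ is chain-related to $y$) if for every $\varepsilon>0$ there is an $\varepsilon$-chain from $x$ to $y$. A chain $C:x_0,\dots,x_m$ is acyclic if the points $x_1,\dots,x_{m-1}$ are pairwise distinct and none of them equals $x_0$ or $x_m$ (the case $x_0=x_m$ is allowed). A sequence of chains is nested if $\widehat{C_n}\subseteq\widehat{C_{n+1}}$ for every $n$. An acyclic chain $C$ induces on its support the relation: $u\le_C v$ iff $u=x_i$, $v=x_j$ for some $i\le j$; it is a linear order on $\widehat C\setminus\{x,y\}$ (and on $\widehat C$ if $x\ne y$). Write $\le_n$ for $\le_{C_n}$. A nested sequence of acyclic chains is order-compatible if for every $n$ and all $u,v\in\widehat{C_n}$, $u\le_n v$ implies $u\le_{n+1}v$. An order-type is an isomorphism class of linearly ordered sets. A metric on $X$ is compatible if it induces the topology of $X$. *)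

(* Defs.v *)
From mathcomp Require Import all_boot all_order all_algebra.
From mathcomp Require wochoice.
From mathcomp Require Import all_classical all_reals all_analysis.

Set Implicit Arguments.
Unset Strict Implicit.
Unset Printing Implicit Defensive.

Import Order.TTheory GRing.Theory Num.Theory.
Import numFieldNormedType.Exports.

Local Open Scope classical_set_scope.
Local Open Scope ring_scope.

(** * Compatible metrics, homeomorphisms *)

Definition is_metric (R : realType) (X : Type) (d : X -> X -> R) : Prop :=
  [/\ forall x, d x x = 0,
      forall x y, d x y = 0 -> x = y,
      forall x y, d x y = d y x &
      forall x y z, d x z <= d x y + d y z].

(** [nbhs_ball_ B x] is the filter generated by the [B x e] with [0 < e]. *)
Definition compatible_metric (R : realType) (X : topologicalType)
    (d : X -> X -> R) : Prop :=
  is_metric d /\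
  forall x : X, nbhs x = nbhs_ball_ (fun z (e : R) => [set t | d z t < e]) x.

Definition homeomorphism (X Y : topologicalType) (h : X -> Y) : Prop :=
  continuous h /\ exists k : Y -> X, [/\ cancel h k, cancel k h & continuous k].

(** * Chains *)

(** The chain [x_0, ..., x_m] is the sequence [C] of size [m + 1] with
    [x_i = nth _ C i]; the default value of [nth] is irrelevant, since indices
    are always bounded by [m = (size C).-1]. *)
Definition is_chain (R : realType) (X : eqType) (d : X -> X -> R) (f : X -> X)
    (e : R) (x y : X) (C : seq X) : Prop :=
  [/\ (1 < size C)%N, nth x C 0 = x, nth x C (size C).-1 = y &
      forall i, (i < (size C).-1)%N -> d (f (nth x C i)) (nth x C i.+1) < e].

Definition chain_related (R : realType) (X : eqType) (d : X -> X -> R)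
    (f : X -> X) (x y : X) : Prop :=
  forall e : R, 0 < e -> exists C, is_chain d f e x y C.

Definition chain_support (X : eqType) (C : seq X) : set X := [set u | u \in C].

(** The points [x_1, ..., x_(m-1)], in this order. *)
Definition interior_points (X : eqType) (C : seq X) : seq X :=
  behead (take (size C).-1 C).

(** Acyclicity of a chain [C] from [x] to [y]. *)
Definition acyclic (X : eqType) (x y : X) (C : seq X) : Prop :=
  [/\ uniq (interior_points C), x \notin interior_points C &
      y \notin interior_points C].

Definition chain_le (X : eqType) (C : seq X) (u v : X) : Prop :=
  exists i j : nat,
    [/\ (i <= j)%N, (j < size C)%N, nth u C i = u & nth v C j = v].

Definition nested (X : eqType) (C : nat -> seq X) : Prop :=
  forall n, chain_support (C n) `<=` chain_support (C n.+1).

Definition order_compatible (X : eqType) (C : nat -> seq X) : Prop :=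
  forall n u v, chain_support (C n) u -> chain_support (C n) v ->
    chain_le (C n) u v -> chain_le (C n.+1) u v.

Definition null_sequence (R : realType) (eps : nat -> R) : Prop :=
  (forall n, 0 < eps n) /\ eps @ \oo --> (0 : R).

(** The sequences of chains that have a limit order-type. *)
Definition order_compatible_chains (R : realType) (X : eqType)
    (d : X -> X -> R) (f : X -> X) (eps : nat -> R) (x y : X)
    (C : nat -> seq X) : Prop :=
  [/\ forall n, is_chain d f (eps n) x y (C n),
      forall n, acyclic x y (C n),
      nested C &
      order_compatible C].

(** * Order-types *)

Record linearly_ordered_set := LinearlyOrderedSet {
  lo_carrier :> Type;
  lo_le : rel lo_carrier;
  lo_total_order : wochoice.total_order lo_le
}.

Definition order_isomorphic (L L' : linearly_ordered_set) : Prop :=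
  exists h : L -> L',
    bijective h /\ forall u v : L, lo_le (h u) (h v) = lo_le u v.

(** Order-types are classes of linearly ordered sets, and [Omega] below is a
    class of order-types.  They are plain predicates because the universe of
    [set] is too small for them. *)
Definition order_type : Type := linearly_ordered_set -> Prop.

Definition order_type_of (L : linearly_ordered_set) : order_type :=
  fun L' => order_isomorphic L L'.

(** * Limit order-types *)

(** The set [S \ {x, y}], with [S] the union of the supports. *)
Definition limit_set (X : eqType) (x y : X) (C : nat -> seq X) : set X :=
  (\bigcup_n chain_support (C n)) `\` [set x; y].

Definition is_limit_order (X : eqType) (x y : X) (C : nat -> seq X)
    (le : rel (limit_set x y C)) : Prop :=
  wochoice.total_order le /\
  forall n (u v : limit_set x y C),
    chain_support (C n) (val u) -> chain_support (C n) (val v) ->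
    (le u v <-> chain_le (C n) (val u) (val v)).

Definition is_limit_order_type (X : eqType) (x y : X) (C : nat -> seq X)
    (t : order_type) : Prop :=
  exists (le : rel (limit_set x y C)) (hle : is_limit_order le),
    t = order_type_of (LinearlyOrderedSet hle.1).

Definition Omega (R : realType) (X : eqType) (f : X -> X) (d : X -> X -> R)
    (eps : nat -> R) (x y : X) : order_type -> Prop :=
  fun t => exists2 C, order_compatible_chains d f eps x y C &
                      is_limit_order_type x y C t.

(* Main.v *)
Require Import Defs.
From mathcomp Require Import all_boot all_order all_algebra.
From mathcomp Require wochoice.
From mathcomp Require Import lra.
From mathcomp Require Import all_classical all_reals all_analysis.

(** Part (a): among the closed sets that contain [e]-chains from [x] to [y] for
    every [e], Zorn's lemma and compactness give a minimal one, [K].  By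
    minimality, for each [p] in [K] every fine enough chain in [K] passes near
    [p], and by uniform continuity a chain point near [p] may be replaced by
    [p].  Hence every finite subset of [K] lies on acyclic chains in [K] that
    are as fine as desired, and these can be nested.

    Part (c): a homeomorphism of compact spaces is uniformly continuous for any
    two compatible metrics, so it maps a subsequence of an order-compatible
    sequence to chains with prescribed tolerances, and the limit order only
    depends on the union of the chains.  The identity gives the independence of
    the metric and of the tolerances. *)

Set Implicit Arguments.
Unset Strict Implicit.
Unset Printing Implicit Defensive.

Import Order.TTheory GRing.Theory Num.Theory.
Import numFieldNormedType.Exports.

Local Open Scope classical_set_scope.
Local Open Scope ring_scope.

(** * Chains as paths, and acyclic subchains *)

Lemma interior_points_rcons (X : eqType) (x y : X) (s : seq X) :
  interior_points (x :: rcons s y) = s.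
Proof. by rewrite /interior_points /= size_rcons /= -cats1 take_size_cat. Qed.

(** The form [x :: rcons s y] isolates the interior [s], also when x = y, and opens chains to the
    theory of [path]. *)
Lemma is_chainP (R : realType) (X : eqType) (d : X -> X -> R) (f : X -> X)
    (e : R) (x y : X) (C : seq X) :
  is_chain d f e x y C <->
  exists2 s, C = x :: rcons s y & path (fun u v => d (f u) v < e) x (rcons s y).
Proof.
split=> [[]|[s -> /(pathP x) sP]].
  case: C => [//|a C]; case/lastP: C => [//|s b] _ /= -> + fC.
  rewrite size_rcons /= nth_rcons ltnn eqxx => by_; subst b.
  exists s => //; apply/(pathP x) => i; rewrite size_rcons => lti.
  by apply: fC; rewrite size_rcons.
split; rewrite /= ?size_rcons //=; first by rewrite nth_rcons ltnn eqxx.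
by move=> i lti; apply: sP; rewrite size_rcons.
Qed.

Lemma is_chainE (R : realType) (X : eqType) (d : X -> X -> R) (f : X -> X)
    (e : R) (x y : X) (C : seq X) :
  is_chain d f e x y C -> C = x :: rcons (interior_points C) y.
Proof. by move/is_chainP => [s -> _]; rewrite interior_points_rcons. Qed.

Lemma is_chain_le (R : realType) (X : eqType) (d : X -> X -> R) (f : X -> X)
    (e e' : R) (x y : X) (C : seq X) :
  e <= e' -> is_chain d f e x y C -> is_chain d f e' x y C.
Proof.
by move=> le_e [? ? ? fC]; split=> // i /fC /lt_le_trans; apply.
Qed.

(** The hypothesis is restricted to points of [C] because the perturbations used later are
    controlled only there. *)
Lemma is_chain_map (R : realType) (X Y : eqType) (d : X -> X -> R)
    (d' : Y -> Y -> R) (f : X -> X) (g : Y -> Y) (h : X -> Y)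
    (e e' : R) (x y : X) (C : seq X) :
  (forall u v, u \in C -> v \in C ->
     d (f u) v < e -> d' (g (h u)) (h v) < e') ->
  is_chain d f e x y C -> is_chain d' g e' (h x) (h y) (map h C).
Proof.
move=> hE [C1 C0 Cm fC].
split; rewrite ?size_map //.
- by rewrite (nth_map x) ?C0 // (ltn_trans _ C1).
- by rewrite (nth_map x) ?Cm // prednK // (ltn_trans _ C1).
- move=> i lti; have ltS : (i.+1 < size C)%N by case: (size C) lti.
  by rewrite !(nth_map x) ?(ltnW ltS) //; apply: hE;
    rewrite ?mem_nth ?(ltnW ltS) ?fC.
Qed.

(** If x recurs in [s], only what follows that occurrence is kept; if y occurs, only what precedes
    it. Otherwise only loops in the interior are left to cut. *)
Lemma shorten_path (X : eqType) (r : rel X) (x y : X) (s : seq X) :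
  path r x (rcons s y) ->
  exists s', [/\ path r x (rcons s' y), {subset s' <= s}, uniq s',
                 x \notin s' & y \notin s'].
Proof.
have [n] := ubnP (size s); elim: n s => // n IHn s ltsn sP.
have [xs|xNs] := boolP (x \in s).
  case/splitPr: xs ltsn sP => s1 s2 ltsn.
  rewrite rcons_cat cat_path /= => /and3P[_ _ /IHn[]].
    by move: ltsn; rewrite size_cat ltnS; apply: leq_trans;
      rewrite addnS ltnS leq_addl.
  move=> s' [? sub ? ? ?]; exists s'; split=> // z /sub zs2.
  by rewrite mem_cat in_cons zs2 !orbT.
have [ys|yNs] := boolP (y \in s).
  case/splitPr: ys ltsn xNs sP => s1 s2 ltsn _.
  rewrite rcons_cat cat_path /= => /and3P[s1P s1y _].
  case: (IHn s1); rewrite ?rcons_path ?s1P//.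
    by move: ltsn; rewrite size_cat ltnS; apply: leq_trans;
      rewrite addnS ltnS leq_addr.
  move=> s' [? sub ? ? ?]; exists s'; split=> // z /sub zs2.
  by rewrite mem_cat zs2.
case: s ltsn sP xNs yNs => [|z s] _; first by exists [::].
rewrite rcons_cons /= => /andP[xz] sP xNs yNs.
(* Loops are cut from the first interior point [z] on: starting at x would collapse a closed chain,
   where x = y. *)
have := last_rcons z s y; case/shortenP: sP => p pP Up sub.
case/lastP: p pP Up sub => [_ _ _ /= zy|p b pP Up sub].
  by move: yNs; rewrite -zy mem_head.
rewrite last_rcons => by_; subst b.
have subp u : u \in p -> u \in s.
  move=> up; have /sub : u \in rcons p y by rewrite mem_rcons inE up orbT.
  rewrite mem_rcons inE => /predU1P[uy|//]; subst u.
  by move: Up; rewrite -rcons_cons rcons_uniq inE up orbT.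
exists (z :: p); split.
- by rewrite rcons_cons /= xz.
- by move=> u; rewrite !inE => /predU1P[->|/subp ->]; rewrite ?eqxx ?orbT.
- by move: Up; rewrite -rcons_cons rcons_uniq => /andP[].
- apply: contra xNs; rewrite !inE => /predU1P[->|/subp ->];
    by rewrite ?eqxx ?orbT.
- by move: Up; rewrite -rcons_cons rcons_uniq => /andP[].
Qed.

Lemma acyclic_subchain (R : realType) (X : eqType) (d : X -> X -> R)
    (f : X -> X) (e : R) (x y : X) (C : seq X) :
  is_chain d f e x y C ->
  exists C', [/\ is_chain d f e x y C', acyclic x y C' & {subset C' <= C}].
Proof.
move/is_chainP => [s -> /shorten_path[s' [s'P sub Us' xs' ys']]].
exists (x :: rcons s' y); split.
- by apply/is_chainP; exists s'.
- by rewrite /acyclic interior_points_rcons.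
- move=> u; rewrite !inE !mem_rcons !inE => /or3P[-> //|->|/sub ->];
    by rewrite /= ?orbT.
Qed.

Lemma chain_ends_mem (X : eqType) (R : realType) (d : X -> X -> R)
    (f : X -> X) (e : R) (x y : X) (C : seq X) :
  is_chain d f e x y C -> x \in C /\ y \in C.
Proof.
by move/is_chainE => ->; rewrite mem_head inE mem_rcons mem_head orbT.
Qed.

Lemma acyclic_map (X Y : eqType) (h : X -> Y) (x y : X) (C : seq X) :
  C = x :: rcons (interior_points C) y -> {in C &, injective h} ->
  acyclic x y C -> acyclic (h x) (h y) (map h C).
Proof.
move=> -> hinj; move: (interior_points C) hinj => s hinj.
rewrite /acyclic map_cons map_rcons !interior_points_rcons => -[Us xs ys].
have sC u : u \in s -> u \in x :: rcons s y.
  by move=> us; rewrite inE mem_rcons inE us !orbT.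
split.
- by rewrite map_inj_in_uniq // => u v /sC us /sC vs; apply: hinj.
- apply: contra xs => /mapP[u us /hinj ->//]; first exact: mem_head.
  exact: sC.
- apply: contra ys => /mapP[u us /hinj ->//]; last exact: sC.
  by rewrite inE mem_rcons mem_head orbT.
Qed.

(** A point other than x and y occupies a single position, namely its index in [s] shifted by one
    for the leading x, so the positions in [chain_le] are forced. *)
Lemma chain_leE (X : eqType) (x y : X) (s : seq X) (u v : X) :
  uniq s -> u \notin [:: x; y] -> v \notin [:: x; y] ->
  chain_le (x :: rcons s y) u v <->
  [/\ u \in s, v \in s & (index u s <= index v s)%N].
Proof.
move=> Us uN vN.
have inner w i : w \notin [:: x; y] -> (i < (size s).+2)%N ->
    nth w (x :: rcons s y) i = w -> w \in s /\ i = (index w s).+1.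
  rewrite !inE negb_or => /andP[wx wy]; case: i => [|i] /=.
    by move=> _ xw; rewrite xw eqxx in wx.
  rewrite !ltnS nth_rcons leq_eqVlt => /predU1P[->|lti].
    by rewrite ltnn eqxx => yw; rewrite yw eqxx in wy.
  by rewrite lti => <-; rewrite mem_nth // index_uniq.
split=> [[i [j [leij ltj iu jv]]]|[us vs lei]].
  rewrite /= size_rcons in ltj.
  have [us iE] := inner _ _ uN (leq_ltn_trans leij ltj) iu.
  have [vs jE] := inner _ _ vN ltj jv.
  by split=> //; move: leij; rewrite iE jE.
exists (index u s).+1, (index v s).+1; split=> //=.
- by rewrite size_rcons !ltnS ltnW // index_mem.
- by rewrite nth_rcons index_mem us nth_index.
- by rewrite nth_rcons index_mem vs nth_index.
Qed.

Lemma chain_le_map (X Y : eqType) (h : X -> Y) (C : seq X) (u v : X) :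
  injective h -> chain_le (map h C) (h u) (h v) <-> chain_le C u v.
Proof.
move=> hinj; split=> -[i [j [leij ltj iu jv]]]; exists i, j.
  move: ltj iu jv; rewrite size_map => ltj.
  have lti := leq_ltn_trans leij ltj.
  by rewrite (nth_map u) // (nth_map v) // => /hinj iu /hinj jv.
have lti := leq_ltn_trans leij ltj.
by rewrite size_map (nth_map u) // (nth_map v) // iu jv.
Qed.

(** * The limit order of an order-compatible sequence *)

Lemma notin_limit_set (X : eqType) (x y : X) (C : nat -> seq X)
    (u : limit_set x y C) : val u \notin [:: x; y].
Proof.
have [_ uN] := set_mem (valP u).
by apply/negP; rewrite !inE => /orP[]/eqP uE; apply: uN; [left|right].
Qed.

Lemma mem_limit_set (X : eqType) (x y : X) (C : nat -> seq X)
    (u : limit_set x y C) : exists n, val u \in C n.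
Proof.
by have [[n _ un] _] := set_mem (valP u); exists n.
Qed.

Lemma nested_subset (X : eqType) (C : nat -> seq X) (m n : nat) :
  nested C -> (m <= n)%N -> {subset C m <= C n}.
Proof.
move=> CS /subnK <-; elim: (n - m)%N => [|k IHk]; first by rewrite add0n.
move=> u /IHk uk.
by rewrite addSn; exact: CS uk.
Qed.

Lemma order_compatible_le (X : eqType) (C : nat -> seq X) (m n : nat)
    (u v : X) :
  nested C -> order_compatible C -> (m <= n)%N -> u \in C m -> v \in C m ->
  chain_le (C m) u v -> chain_le (C n) u v.
Proof.
move=> CS CO /subnK <- uC vC uv; elim: (n - m)%N => [|k IHk].
  by rewrite add0n.
by rewrite addSn; apply: CO => //; apply: (nested_subset CS (leq_addl k m)).
Qed.

Section LimitOrder.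
Variables (X : eqType) (x y : X) (C : nat -> seq X).
Hypotheses (C_ends : forall n, C n = x :: rcons (interior_points (C n)) y)
  (C_acyclic : forall n, acyclic x y (C n))
  (C_nested : nested C) (C_order : order_compatible C).

Implicit Types u v w : limit_set x y C.

Let index_at n u := index (val u) (interior_points (C n)).

Let mem_interior n u : val u \in C n -> val u \in interior_points (C n).
Proof.
have := notin_limit_set u; rewrite C_ends interior_points_rcons !inE negb_or.
by case/andP=> /negPf -> /negPf uy; rewrite /= mem_rcons inE uy.
Qed.

Let chain_le_index n u v : val u \in C n -> val v \in C n ->
  chain_le (C n) (val u) (val v) <-> (index_at n u <= index_at n v)%N.
Proof.
move=> un vn; have [Us _ _] := C_acyclic n.
rewrite /index_at {1}C_ends chain_leE ?notin_limit_set//.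
by split=> [[]//|]; split=> //; exact: mem_interior.
Qed.

Let common_chain u v w :
  exists n, [/\ val u \in C n, val v \in C n & val w \in C n].
Proof.
have [i ui] := mem_limit_set u; have [j vj] := mem_limit_set v.
have [k wk] := mem_limit_set w; exists (maxn i (maxn j k)); split.
- by apply: (nested_subset C_nested _ ui); rewrite leq_maxl.
- by apply: (nested_subset C_nested _ vj); rewrite leq_max leq_maxl orbT.
- by apply: (nested_subset C_nested _ wk); rewrite !leq_max leqnn !orbT.
Qed.

(** Compatibility says only that comparisons persist. They are also reflected: if u does not precede
    v at stage m, then v precedes u there, hence also at stage n, and antisymmetry at stage n forces
    u = v. *)
Let index_stable m n u v :
    val u \in C m -> val v \in C m -> (m <= n)%N ->
  (index_at n u <= index_at n v)%N = (index_at m u <= index_at m v)%N.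
Proof.
move=> um vm le_mn.
have mono u' v' : val u' \in C m -> val v' \in C m ->
    (index_at m u' <= index_at m v')%N -> (index_at n u' <= index_at n v')%N.
  move=> u'm v'm /(chain_le_index u'm v'm) le_m; apply/chain_le_index.
  - exact: (nested_subset C_nested le_mn).
  - exact: (nested_subset C_nested le_mn).
  - exact: order_compatible_le le_m.
apply/idP/idP => [le_n|]; last exact: mono.
have [//|lt_m] := leqP; have le_n' := mono _ _ vm um (ltnW lt_m).
have uv : val u = val v.
  have uI := mem_interior (nested_subset C_nested le_mn um).
  have vI := mem_interior (nested_subset C_nested le_mn vm).
  rewrite -(nth_index x uI) -(nth_index x vI); congr nth.
  by apply/eqP; rewrite eqn_leq; apply/andP.
by move: lt_m; rewrite /index_at uv ltnn.
Qed.

Let limit_le u v : bool :=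
  `[< exists n, [/\ val u \in C n, val v \in C n &
                   (index_at n u <= index_at n v)%N] >].

(** The stage that witnesses [limit_le] is immaterial: two stages are compared through their
    maximum. *)
Let limit_leE n u v : val u \in C n -> val v \in C n ->
  limit_le u v = (index_at n u <= index_at n v)%N.
Proof.
move=> un vn; apply/asboolP/idP => [[m [um vm]]|]; last by exists n.
rewrite -(index_stable um vm (leq_maxr n m)).
by rewrite (index_stable un vn (leq_maxl n m)).
Qed.

Lemma limit_order_exists : exists le : rel (limit_set x y C), is_limit_order le.
Proof.
exists limit_le; split; last first.
  move=> n u v un vn; rewrite (limit_leE un vn).
  by split=> /chain_le_index; apply.
split; first split; first split.
- move=> u; have [n [un _ _]] := common_chain u u u.
  by rewrite (limit_leE un un).
- move=> v u w; have [n [un vn wn]] := common_chain u v w.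
  by rewrite !(limit_leE (n := n))//; exact: leq_trans.
- move=> u v; have [n [un vn _]] := common_chain u v v.
  rewrite !(limit_leE (n := n))// -eqn_leq => /eqP uv.
  have uvE : val u = val v.
    rewrite -(nth_index x (mem_interior un)) -(nth_index x (mem_interior vn)).
    by congr nth.
  exact: (val_inj uvE).
- move=> u v; have [n [un vn _]] := common_chain u v v.
  by rewrite !(limit_leE (n := n))//; exact: leq_total.
Qed.

Lemma limit_order_unique (le le' : rel (limit_set x y C)) :
  is_limit_order le -> is_limit_order le' -> le = le'.
Proof.
move=> [_ leP] [_ leP']; apply/funext => u; apply/funext => v.
have [n [un vn _]] := common_chain u v v.
by apply/idP/idP => [/(leP n u v un vn)/leP'|/(leP' n u v un vn)/leP]; apply.
Qed.

Lemma limit_order_type_exists : exists t, is_limit_order_type x y C t.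
Proof.
have [le hle] := limit_order_exists.
by exists (order_type_of (LinearlyOrderedSet hle.1)), le, hle.
Qed.

Lemma limit_order_type_unique (t t' : order_type) :
  is_limit_order_type x y C t -> is_limit_order_type x y C t' -> t = t'.
Proof.
move=> [le [hle ->]] [le' [hle' ->]].
have lele' := limit_order_unique hle hle'; subst le'.
(* The bundled ordered sets contain the proofs of totality, which proof irrelevance identifies. *)
by rewrite (Prop_irrelevance hle hle').
Qed.

End LimitOrder.

(** * Order-types and their transport along bijections *)

Lemma order_isomorphic_sym (L L' : linearly_ordered_set) :
  order_isomorphic L L' -> order_isomorphic L' L.
Proof.
move=> [h [[k hk kh] hle]]; exists k; split; first by exists h.
by move=> u v; rewrite -hle !kh.
Qed.

Lemma order_isomorphic_trans (L1 L2 L3 : linearly_ordered_set) :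
  order_isomorphic L1 L2 -> order_isomorphic L2 L3 -> order_isomorphic L1 L3.
Proof.
move=> [h [hbij hle]] [k [kbij kle]]; exists (k \o h); split.
  exact: bij_comp.
by move=> u v; rewrite /= kle hle.
Qed.

Lemma order_type_of_isomorphic (L L' : linearly_ordered_set) :
  order_isomorphic L L' -> order_type_of L = order_type_of L'.
Proof.
move=> LL'; apply/funext => M; apply/propext; split.
  exact/order_isomorphic_trans/order_isomorphic_sym.
exact: order_isomorphic_trans.
Qed.

(** As n <= k n, the chains [C (k n)] still exhaust the union, so [h] restricts to a bijection of
    the limit sets. Any two points lie on one [C (k n)], and there both orders are read off the same
    positions. *)
Lemma is_limit_order_type_transport (X Y : eqType) (h : X -> Y) (x y : X)
    (C : nat -> seq X) (D : nat -> seq Y) (k : nat -> nat)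
    (leC : rel (limit_set x y C)) (leD : rel (limit_set (h x) (h y) D))
    (hC : is_limit_order leC) (hD : is_limit_order leD) :
  bijective h -> nested C -> (forall n, (n <= k n)%N) ->
  (forall n, D n = map h (C (k n))) ->
  order_isomorphic (LinearlyOrderedSet hC.1) (LinearlyOrderedSet hD.1).
Proof.
move=> [g hK gK] CS le_k DE; have hI := can_inj hK.
have fwd (u : limit_set x y C) : limit_set (h x) (h y) D (h (val u)).
  have [n un] := mem_limit_set u.
  have := notin_limit_set u; rewrite !inE /= => uN.
  split.
    exists n => //=; rewrite /chain_support /= DE map_f//.
    exact: nested_subset CS (le_k n) _ un.
  by case=> /= /hI uE; rewrite uE eqxx ?orbT in uN.
have bwd (v : limit_set (h x) (h y) D) : limit_set x y C (g (val v)).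
  have [n vn] := mem_limit_set v.
  have := notin_limit_set v; rewrite !inE /= => vN.
  split.
    exists (k n) => //=; move: vn; rewrite /chain_support DE /=.
    by move=> /mapP[u un ->]; rewrite hK.
  by case=> /= vE; rewrite -[val v]gK vE eqxx ?orbT in vN.
exists (fun u => SigSub (mem_set (fwd u))); split.
  exists (fun v => SigSub (mem_set (bwd v))) => [u|v]; apply: val_inj => /=.
    exact: hK.
  exact: gK.
move=> u v /=; have [i ui] := mem_limit_set u; have [j vj] := mem_limit_set v.
set n := maxn i j.
have uk : val u \in C (k n).
  by apply: nested_subset ui => //; rewrite (leq_trans _ (le_k n)) ?leq_maxl.
have vk : val v \in C (k n).
  by apply: nested_subset vj => //; rewrite (leq_trans _ (le_k n)) ?leq_maxr.
have [_ leCE] := hC; have [_ leDE] := hD.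
have := leDE n (SigSub (mem_set (fwd u))) (SigSub (mem_set (fwd v))).
rewrite /chain_support /= !DE !map_f // chain_le_map// => /(_ isT isT) leDC.
by apply/idP/idP => [/leDC/(leCE _ u v uk vk)|/(leCE _ u v uk vk)/leDC].
Qed.

(** * Compatible metrics and uniform continuity *)

Lemma compatible_mdist (R : realType) (X : metricType R) :
  compatible_metric (@mdist R X).
Proof.
split; first split.
- exact: mdistxx.
- by move=> x y; exact: mdist_positivity.
- exact: metric_sym.
- exact: metric_triangle.
- by move=> x; rewrite -metricType_numDomainType.nbhs_nbhs_mdist.
Qed.

Section CompatibleMetric.
Variables (R : realType) (X : topologicalType) (d : X -> X -> R).
Hypothesis dX : compatible_metric d.

Lemma metric_ball_nbhs (x : X) (e : R) : 0 < e -> nbhs x [set z | d x z < e].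
Proof. by move=> e0; case: dX => _ ->; exists e. Qed.

Lemma open_metric_ball (x : X) (e : R) : open [set z | d x z < e].
Proof.
have [[_ _ _ dtri] nbhsE] := dX.
rewrite openE => z /= dxz; rewrite /interior nbhsE.
exists (e - d x z); first by rewrite /= subr_gt0.
by move=> w /=; rewrite ltrBrDl; apply: le_lt_trans.
Qed.

(** Compactness is used as a near-covering property, with parameter [del] tending to 0 from the
    right. If the ball of radius r about z maps within e/2 of h z, then u within r/2 of z and [del]
    < r/2 keep both u and v in that ball. *)
Lemma compact_uniform_continuity (Y : topologicalType) (d' : Y -> Y -> R)
    (h : X -> Y) (e : R) :
  compact [set: X] -> compatible_metric d' -> continuous h -> 0 < e ->
  exists2 del, 0 < del & forall u v, d u v < del -> d' (h u) (h v) < e.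
Proof.
move=> /compact_near_coveringP cX dY hc e0.
have [[_ _ dsym dtri] nbhsE] := dX; have [[_ _ dsym' dtri'] nbhsE'] := dY.
have e20 : 0 < e / 2 by rewrite divr_gt0.
have [del /= del0 cov] : \forall del \near 0^'+, [set: X] `<=`
    (fun u => forall v, d u v < del -> d' (h u) (h v) < e).
  apply: cX => z _.
  have : nbhs z [set w | d' (h z) (h w) < e / 2].
    have : nbhs (h z) [set w | d' (h z) w < e / 2].
      by rewrite nbhsE'; exists (e / 2).
    exact: hc.
  rewrite nbhsE => -[r /= r0 hr].
  have r20 : 0 < r / 2 by rewrite divr_gt0.
  exists ([set w | d z w < r / 2], [set del : R | del < r / 2]).
    by split; [exact: metric_ball_nbhs|exact: nbhs_right_lt].
  move=> [u del] /= [zu lt_del] v uv.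
  have hu : d' (h z) (h u) < e / 2 by apply: hr => /=; lra.
  have hv : d' (h z) (h v) < e / 2.
    by apply: hr => /=; have := dtri z u v; lra.
  by have := dtri' (h u) (h z) (h v); rewrite (dsym' (h u) (h z)); lra.
(* Here [del] is the radius of a right neighbourhood of 0 of good values; [del / 2] lies inside
   it. *)
exists (del / 2); first by rewrite divr_gt0.
move=> u v; apply: (cov (del / 2)) => //=; last by rewrite divr_gt0.
by rewrite sub0r normrN gtr0_norm ?divr_gt0// gtr_pMr// invf_lt1// ltr1n.
Qed.

End CompatibleMetric.

(** * Minimal carriers and nested acyclic chains *)

Section ChainDynamics.
Variables (R : realType) (X : topologicalType) (d : X -> X -> R) (f : X -> X).
Hypotheses (cX : compact [set: X]) (dX : compatible_metric d)
  (fc : continuous f).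

(** Each of d(f(phi u), f u), d(f u, v) and d(v, phi v) is below e/3, the first by uniform
    continuity of f. The map [phi] need not be continuous. *)
Lemma perturbed_chain (e : R) : 0 < e ->
  exists2 del, 0 < del & forall x y C (phi : X -> X), is_chain d f del x y C ->
    (forall u, u \in C -> d u (phi u) < del) -> phi x = x -> phi y = y ->
    is_chain d f e x y (map phi C).
Proof.
move=> e0; have [[_ _ dsym dtri] _] := dX.
have e30 : 0 < e / 3 by rewrite divr_gt0.
have [del del0 fdel] := compact_uniform_continuity dX cX dX fc e30.
exists (Num.min del (e / 3)); first by rewrite lt_min del0.
move=> x y C phi Cch Cphi phix phiy; rewrite -{1}phix -{1}phiy.
apply: is_chain_map Cch => u v /Cphi + /Cphi.
rewrite !lt_min => /andP[uphi _] /andP[_ vphi] /andP[_ uv].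
rewrite dsym in uphi.
have := dtri (f (phi u)) (f u) (phi v); have := dtri (f u) v (phi v).
have := fdel _ _ uphi; lra.
Qed.

Definition carries_chains (x y : X) (K : set X) : Prop :=
  forall e : R, 0 < e ->
    exists2 C, is_chain d f e x y C & forall u, u \in C -> K u.

Lemma carries_chains_ends (x y : X) (K : set X) :
  carries_chains x y K -> K x /\ K y.
Proof.
move=> /(_ _ ltr01)[C /chain_ends_mem[xC yC] CK].
by split; apply: CK.
Qed.

(* Zorn's lemma is applied to the complements, so that the carrying sets
   themselves are closed and minimal. *)
Lemma minimal_carrier (x y : X) : chain_related d f x y ->
  exists A : set X, [/\ open A, carries_chains x y (~` A) &
    forall B, open B -> A `<` B -> ~ carries_chains x y (~` B)].
Proof.
move=> xy.
have [|A [[oA cA] maxA]] :=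
  @Zorn_bigcup X [set A | open A /\ carries_chains x y (~` A)].
  move=> F FP Ftot; have [->|/set0P[A1 FA1]] := eqVneq F set0.
    rewrite bigcup_set0; split; first exact: open0.
    by move=> e /xy[C Cch]; exists C => // u _ [].
  split; first by apply: bigcup_open => A /FP[].
  set K := ~` _ => e /perturbed_chain[del del0 pert].
  have [Kx Ky] : K x /\ K y.
    split=> -[A FA]; have [_ cA] := FP A FA;
      by have [] := carries_chains_ends cA.
  (* The space is covered by [V], the [del]-neighbourhood of K, and the members of F. With [G] the
     filter of tails of F, compactness yields a single A in F such that A and [V] cover
     everything. *)
  pose V := [set z | exists2 k, K k & d k z < del].
  pose G := filter_from F (fun A => [set B | F B /\ A `<=` B]).
  have GF : Filter G.
    apply: filter_from_filter; first by exists A1.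
    move=> A B FA FB; have [AB|BA] := Ftot A B FA FB.
      by exists B => // D [FD BD]; split; split=> //; apply: subset_trans BD.
    by exists A => // D [FD AD]; split; split=> //; apply: subset_trans AD.
  have [z _|A FA Acov] := (iffLR (compact_near_coveringP _) cX) _ G
      (fun (B : set X) z => B z \/ V z) GF.
    have [Kz|/contrapT[A FA Az]] := pselect (K z).
      exists ([set w | d z w < del], setT).
        by split; [exact: metric_ball_nbhs|exact: filterT].
      by move=> [w B] /= [zw _]; right; exists z.
    exists (A, [set B | F B /\ A `<=` B]).
      split; last by exists A.
      by apply: open_nbhs_nbhs; split=> //; have [] := FP A FA.
    by move=> [w B] /= [Aw [_ AB]]; left; apply: AB.
  have [_ /(_ _ del0)[C Cch CA]] := FP A FA.
  (* A chain avoiding A is pushed into K by moves smaller than [del]; points of K, in particular x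
     and y, stay fixed. *)
  have near_K u : exists k, (~ A u -> K k /\ d u k < del) /\ (K u -> k = u).
    have [[dxx _ dsym _] _] := dX.
    have [Ku|nKu] := pselect (K u); first by exists u; rewrite dxx.
    have [Au|nAu] := pselect (A u); first by exists u.
    have [|//|[k Kk ku]] := Acov A _ u I; first by split.
    by exists k; rewrite dsym.
  have [phi phiP] := choice near_K.
  exists (map phi C).
    apply: pert => //; last 2 first.
    - by apply (phiP x).2.
    - by apply (phiP y).2.
    - by move=> u /CA /(phiP u).1[].
  by move=> _ /mapP[u /CA /(phiP u).1[Kk _] ->].
exists A; split=> // B oB /maxA + cB; exact.
Qed.

Lemma separating_radius (s : seq X) (p : X) : p \notin s ->
  exists2 r : R, 0 < r & forall u, u \in s -> r <= d p u.
Proof.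
have [[dxx dpos dsym dtri] _] := dX.
elim: s => [_|v s IHs]; first by exists 1.
rewrite inE negb_or => /andP[pv /IHs[r r0 rs]].
have dge0 : 0 <= d p v.
  by have := dtri p v p; rewrite dxx (dsym v p) -mulr2n pmulrn_lge0.
have dgt0 : 0 < d p v.
  by rewrite lt_neqAle dge0 andbT eq_sym; apply: contra_neq pv => /dpos.
exists (Num.min r (d p v)); first by rewrite lt_min r0.
by move=> u; rewrite inE ge_min => /predU1P[->|/rs ->//]; rewrite lexx orbT.
Qed.

(* By minimality of the carrier, every sufficiently fine chain in it passes
   near p; moving one such point to p inserts p into the chain. *)
Lemma acyclic_chain_through (x y : X) (A : set X) :
  open A -> carries_chains x y (~` A) ->
  (forall B, open B -> A `<` B -> ~ carries_chains x y (~` B)) ->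
  forall (F : seq X) (e : R), (forall u, u \in F -> ~ A u) -> 0 < e ->
  exists C, [/\ is_chain d f e x y C, acyclic x y C,
    forall u, u \in C -> ~ A u & {subset F <= C}].
Proof.
move=> oA cA maxA; elim=> [|p F IHF] e FA e0.
  have [C /acyclic_subchain[C' [C'ch C'ac sub]] CA] := cA e e0.
  by exists C'; split=> // u /sub /CA.
have FA' u : u \in F -> ~ A u by move=> uF; apply: FA; rewrite inE uF orbT.
have pA : ~ A p by apply: FA; rewrite mem_head.
have [del del0 pert] := perturbed_chain e0.
have [ps|pNs] := boolP (p \in [:: x, y & F]).
  have [C [Cch Cac CA FC]] := IHF e FA' e0; exists C; split=> // u.
  have [xC yC] := chain_ends_mem Cch.
  rewrite inE => /predU1P[->|/FC//]; move: ps; rewrite !inE.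
  by move=> /or3P[/eqP->|/eqP->|/FC].
have [[dxx _ dsym _] _] := dX.
have [r0 r00 r0s] := separating_radius pNs.
(* The bound [r0] keeps x, y and [F] out of the ball about p, so that none of them is the point to
   be moved; [del] makes the move admissible. *)
pose r := Num.min r0 del.
pose B := A `|` [set z | d p z < r].
have r_gt0 : 0 < r by rewrite lt_min r00.
have oB : open B by apply: openU => //; exact: open_metric_ball.
have AB : A `<` B.
  split; first by move=> u; left.
  by move=> /(_ p) BA; apply/pA/BA; right; rewrite /= dxx.
have /existsNP[e1 /not_implyP[e10 noC]] := maxA B oB AB.
(* Here [e1] forces the chain to meet [B], [del] allows the perturbation, and [e] serves the case
   where p is already on the chain. *)
have : 0 < Num.min e1 (Num.min del e) by rewrite !lt_min e10 del0.
move=> /(IHF _ FA')[C [Cch Cac CA FC]].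
have [q [qC Bq]] : exists q, q \in C /\ B q.
  apply: contrapT => CB; apply: noC; exists C.
    by apply: is_chain_le Cch; rewrite ge_min lexx.
  by move=> u uC Bu; apply: CB; exists u.
have {Bq} pq : d p q < r by case: Bq => // /(CA _ qC).
have qNs : q \notin [:: x, y & F].
  apply/negP => /r0s; rewrite leNgt => /negP; apply.
  by apply: lt_le_trans pq _; rewrite ge_min lexx.
have [pC|pNC] := boolP (p \in C).
  exists C; split=> //.
    by apply: is_chain_le Cch; rewrite !ge_min lexx !orbT.
  by move=> u; rewrite inE => /predU1P[->|/FC].
(* Since p is not on [C], this replacement is injective on [C] and preserves acyclicity. *)
pose phi u := if u == q then p else u.
have phi_id u : u \in [:: x, y & F] -> phi u = u.
  by rewrite /phi; case: eqP => // ->; rewrite (negPf qNs).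
have phix : phi x = x by rewrite phi_id ?mem_head.
have phiy : phi y = y by rewrite phi_id // !inE eqxx orbT.
exists (map phi C); split.
- apply: pert => //; first by apply: is_chain_le Cch; rewrite !ge_min lexx orbT.
  move=> u _; rewrite /phi; case: eqP => [->|_]; last by rewrite dxx.
  by rewrite dsym (lt_le_trans pq)// ge_min lexx orbT.
- rewrite -phix -phiy; apply: acyclic_map => //; first exact: is_chainE Cch.
  move=> u v uC vC; rewrite /phi.
  case: eqP => [->|_]; case: eqP => [->|_]//.
  + by move=> pv; rewrite pv vC in pNC.
  + by move=> up; rewrite -up uC in pNC.
- move=> _ /mapP[u uC ->]; rewrite /phi; case: eqP => // _; exact: CA.
- move=> u; rewrite inE => /predU1P[->|uF].
    by apply/mapP; exists q => //; rewrite /phi eqxx.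
  by apply/mapP; exists u; rewrite ?FC // phi_id // !inE uF !orbT.
Qed.

(** Each chain is chosen to pass through all points of its predecessor. This can be iterated because
    every chain stays in the minimal carrier. *)
Lemma nested_acyclic_chains (x y : X) (eps : nat -> R) :
  chain_related d f x y -> (forall n, 0 < eps n) ->
  exists C : nat -> seq X, [/\ forall n, is_chain d f (eps n) x y (C n),
    nested C & forall n, acyclic x y (C n)].
Proof.
move=> /minimal_carrier[A [oA cA maxA]] eps0.
(* The carrier condition sits under the existential so that [choice] gives a total function; [[::]]
   is a dummy value when the condition fails. *)
have step (nF : nat * seq X) : exists C, (forall u, u \in nF.2 -> ~ A u) ->
    [/\ is_chain d f (eps nF.1) x y C, acyclic x y C,
      forall u, u \in C -> ~ A u & {subset nF.2 <= C}].
  have [FA|nFA] := pselect (forall u, u \in nF.2 -> ~ A u); last by exists [::].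
  by have [C CP] := acyclic_chain_through oA cA maxA FA (eps0 nF.1); exists C.
have [G GP] := choice step.
pose fix C n := if n is m.+1 then G (n, C m) else G (0, [::]).
have CA n u : u \in C n -> ~ A u.
  elim: n u => [|n IHn] u uC.
    by have [//|_ _ + _] := GP (0, [::]); apply.
  by have [//|_ _ + _] := GP (n.+1, C n); apply.
exists C; split.
- by case=> [|n]; [have [//|] := GP (0, [::])|
                   have [|] := GP (n.+1, C n); first exact: CA].
- by move=> n u /=; have [|_ _ _] := GP (n.+1, C n); [exact: CA|apply].
- by case=> [|n]; [have [//|] := GP (0, [::])|
                   have [|] := GP (n.+1, C n); first exact: CA].
Qed.

End ChainDynamics.

(** * Invariance of the set of limit order-types *)

Lemma null_sequence_subsequence (R : realType) (eps del : nat -> R) :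
  null_sequence eps -> (forall n, 0 < del n) ->
  exists k : nat -> nat, [/\ forall n, (n <= k n)%N,
    forall n, (k n <= k n.+1)%N & forall n, eps (k n) < del n].
Proof.
move=> [eps0 eps_cvg] del0.
have epsN n : exists N, forall m, (N <= m)%N -> eps m < del n.
  have /cvgrPdist_lt/(_ _ (del0 n))[N _ epsN] := eps_cvg.
  exists N => m /epsN /=.
  by rewrite sub0r normrN gtr0_norm.
have [N NP] := choice epsN.
(* Partial sums are monotone and dominate each [N n]; the successors make them at least n. *)
exists (fun n => (\sum_(i < n.+1) (N i).+1)%N); split=> n.
- elim: n => // n IHn; rewrite big_ord_recr /= (leq_ltn_trans IHn)//.
  by rewrite -addSnnS leq_addr.
- by rewrite [leqRHS]big_ord_recr leq_addr.
- by apply: NP; rewrite big_ord_recr /= addnS ltnW // ltnS leq_addl.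
Qed.

(* Only the tail of the sequence of chains matters for the limit order, so it
   may be thinned out until the images under h are fine enough. *)
Lemma Omega_homeomorphism (R : realType) (X Y : topologicalType)
    (f : X -> X) (g : Y -> Y) (h : X -> Y) (d : X -> X -> R) (dY : Y -> Y -> R)
    (eps epsY : nat -> R) (x y : X) (t : order_type) :
  compact [set: X] -> compatible_metric d -> compatible_metric dY ->
  null_sequence eps -> (forall n, 0 < epsY n) ->
  continuous h -> bijective h -> h \o f = g \o h ->
  Omega f d eps x y t -> Omega g dY epsY (h x) (h y) t.
Proof.
move=> cX dX dYc eps_null epsY0 hc hbij hfg [C [Cch Cac CS CO] [le [hle ->]]].
have hI := bij_inj hbij.
have unif n : exists del : R, 0 < del /\
    forall u v, d u v < del -> dY (h u) (h v) < epsY n.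
  have [del del0 hdel] := compact_uniform_continuity dX cX dYc hc (epsY0 n).
  by exists del.
have [del delP] := choice unif.
have [k [le_k k_mono k_eps]] :=
  null_sequence_subsequence eps_null (fun n => (delP n).1).
pose D n := map h (C (k n)).
have Dch n : is_chain dY g (epsY n) (h x) (h y) (D n).
  apply: is_chain_map (Cch (k n)) => u v _ _ uv.
  rewrite -[g (h u)]/((g \o h) u) -hfg; apply: (delP n).2.
  exact: lt_trans uv (k_eps n).
have Dac n : acyclic (h x) (h y) (D n).
  by apply: acyclic_map (Cac _); [exact: is_chainE (Cch _)|exact: in2W].
have DS : nested D.
  move=> n _ /mapP[u un ->]; apply: map_f.
  exact: nested_subset CS (k_mono n) _ un.
have DO : order_compatible D.
  move=> n _ _ /mapP[u un ->] /mapP[v vn ->] /(chain_le_map _ _ _ hI) uv.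
  exact/(chain_le_map _ _ _ hI)/(order_compatible_le CS CO (k_mono n)).
exists D; first by split.
have [leD hleD] := limit_order_exists (fun n => is_chainE (Dch n)) Dac DS DO.
exists leD, hleD; apply: order_type_of_isomorphic.
exact: is_limit_order_type_transport.
Qed.

(** Both inclusions are instances of [Omega_homeomorphism], for [h] and for its inverse, which
    conjugates g to f. *)
Lemma Omega_conjugacy (R : realType) (X Y : topologicalType)
    (f : X -> X) (g : Y -> Y) (h : X -> Y) (d : X -> X -> R) (dY : Y -> Y -> R)
    (eps epsY : nat -> R) (x y : X) :
  compact [set: X] -> compact [set: Y] ->
  compatible_metric d -> compatible_metric dY ->
  null_sequence eps -> null_sequence epsY ->
  homeomorphism h -> h \o f = g \o h ->
  Omega f d eps x y = Omega g dY epsY (h x) (h y).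
Proof.
move=> cX cY dX dYc e0 e0Y [hc [k [hK kK kc]]] hfg.
apply/funext => t; apply/propext; split.
  apply: Omega_homeomorphism => //; first exact: e0Y.1.
  by exists k.
rewrite -{2}[x]hK -{2}[y]hK; apply: Omega_homeomorphism => //.
- exact: e0.1.
- by exists h.
- apply/funext => v /=; apply: (can_inj hK); rewrite kK.
  by have /= -> := congr1 (fun F => F (k v)) hfg; rewrite kK.
Qed.

Theorem mainTheorem1 (R : realType) (X : metricType R)
    (compactX : compact [set: X]) (f : X -> X) (contf : continuous f) :
  (* (a) *)
  (forall x y : X, chain_related (@mdist R X) f x y ->
     exists (eps : nat -> R) (C : nat -> seq X),
       [/\ null_sequence eps,
           forall n, is_chain (@mdist R X) f (eps n) x y (C n),
           nested C &
           forall n, acyclic x y (C n)]) /\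
  (* (b) *)
  (forall (x y : X) (eps : nat -> R) (C : nat -> seq X),
     null_sequence eps ->
     order_compatible_chains (@mdist R X) f eps x y C ->
     (exists! le : rel (limit_set x y C), is_limit_order le) /\
     (exists! t : order_type, is_limit_order_type x y C t)) /\
  (* (c) independence of the metric and of the sequence *)
  (forall (x y : X) (d d' : X -> X -> R) (eps eps' : nat -> R),
     compatible_metric d -> compatible_metric d' ->
     null_sequence eps -> null_sequence eps' ->
     Omega f d eps x y = Omega f d' eps' x y) /\
  (* (c) invariance under topological conjugacy *)
  (forall (Y : metricType R) (g : Y -> Y) (h : X -> Y),
     compact [set: Y] -> continuous g ->
     homeomorphism h -> h \o f = g \o h ->
     forall (x y : X) (d : X -> X -> R) (dY : Y -> Y -> R)
       (eps epsY : nat -> R),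
       compatible_metric d -> compatible_metric dY ->
       null_sequence eps -> null_sequence epsY ->
       Omega f d eps x y = Omega g dY epsY (h x) (h y)).
Proof.
have dX := compatible_mdist X.
split; [|split; [|split]].
- move=> x y xy; have e0 := @harmonic_gt0 R.
  have [C [Cch CS Cac]] := nested_acyclic_chains compactX dX contf xy e0.
  by exists harmonic, C; split=> //; split=> //; exact: cvg_harmonic.
- move=> x y eps C _ [Cch Cac CS CO].
  have Cends n := is_chainE (Cch n); split.
    have [le hle] := limit_order_exists Cends Cac CS CO.
    by exists le; split=> // le'; exact: limit_order_unique.
  have [t ht] := limit_order_type_exists Cends Cac CS CO.
  by exists t; split=> // t'; exact: limit_order_type_unique.
- move=> x y d d' eps eps' dc d'c e0 e0'.
  apply: (@Omega_conjugacy _ _ _ f f id) => //.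
  by split; [|exists id; split]; move=> // ?; exact: cvg_id.
- move=> Y g h cY _ hh hfg x y d dY eps epsY dc dYc e0 e0Y.
  exact: Omega_conjugacy.
Qed.
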